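(* Let $n\ge 0$ be an integer and let $\mathcal P_n$ be the space of complex polynomials of degree at most $n$. Then, as linear operators on $\mathcal P_n$, $$F_n\,U_n^{-1}=V_n^{-1}\,C_n\,V_n .$$
   Context: The Euler polynomials $A_k(x)$ are defined by $\frac{A_k(x)}{(1-x)^{k+1}}=\sum_{m\ge0}m^kx^m$, with $A_0=1$ (using $0^0=1$). All operators are linear operators on $\mathcal P_n$ given on monomials $x^p$, $p=0,\dots,n$: $U_n x^p=\frac1{n!}(1-x)^{n-p}A_p(x)=(1-x)^{n+1}\frac1{n!}\sum_{m\ge0}m^px^m$ (invertible; explicitly $U_n^{-1}x^p=(x)_p[x+1]_{n-p}$, where $(\varphi)_k=\varphi(\varphi-1)\cdots(\varphi-k+1)$, $[\varphi]_k=\varphi(\varphi+1)\cdots(\varphi+k-1)$, both $=1$ for $k=0$); $F_n x^p=(1-x)^{2n+1}\sum_{m\ge0}m^p\binom{m+n}{n}x^m$ (a polynomial of degree $\le n$; $0^0=1$); $V_nx^p=(1+x)^{n-p}x^p$ (so $V_n^{-1}x^p=(1-x)^{n-p}x^p$); $C_nx^p=\frac{(n+p)!}{p!}x^p$. *)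

(* Defs.v *)
From HB Require Import structures.
From mathcomp Require Import all_boot all_order all_algebra.
From mathcomp Require Export qpoly vector.
From mathcomp Require Import zify ring.

Set Implicit Arguments.
Unset Strict Implicit.
Unset Printing Implicit Defensive.

Import Order.TTheory GRing.Theory Num.Theory.
Local Open Scope ring_scope.

(* A formal power series is its coefficient sequence nat -> K; polynomials are
   series through nth 0, and the product is the Cauchy product. *)
Definition fps_mul (K : pzRingType) (s t : nat -> K) : nat -> K :=
  fun k => \sum_(i < k.+1) s i * t (k - i)%N.

Section Operators.
Variable K : numFieldType.
Implicit Types (n p : nat).

(* (1 - x)^(k+1) \sum_m m^k x^m.  Only the first k + 1 coefficients are kept;
   eulerP shows that the others vanish. *)
Definition euler (k : nat) : {poly K} :=
  \poly_(j < k.+1) fps_mul (nth 0 ((1 - 'X) ^+ k.+1 : {poly K}))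
                           (fun m => m%:R ^+ k) j.

(* The space of polynomials of degree at most n is {poly_n.+1 K}.  Here the
   operator with x^p |-> f p for p <= n; all the f p used below have degree at
   most n, so that npolyp discards nothing (see the op*_monomial lemmas). *)
Definition on_monomials n (f : nat -> {poly K}) (q : {poly_n.+1 K}) :
    {poly_n.+1 K} := \sum_(p < n.+1) q`_p *: npolyp n.+1 (f p).

Definition monomial_op n (f : nat -> {poly K}) : 'End({poly_n.+1 K}) :=
  linfun (on_monomials f).

Definition opU n : 'End({poly_n.+1 K}) :=
  monomial_op n (fun p => (n`!%:R)^-1 *: ((1 - 'X) ^+ (n - p) * euler p)).

(* Truncated at degree n; opF_monomial shows that the rest of the series
   vanishes. *)
Definition opF n : 'End({poly_n.+1 K}) :=
  monomial_op n (fun p => \poly_(j < n.+1)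
    fps_mul (nth 0 ((1 - 'X) ^+ (2 * n).+1 : {poly K}))
            (fun m => m%:R ^+ p * 'C(m + n, n)%:R) j).

Definition opV n : 'End({poly_n.+1 K}) :=
  monomial_op n (fun p => (1 + 'X) ^+ (n - p) * 'X^p).

Definition opC n : 'End({poly_n.+1 K}) :=
  monomial_op n (fun p => ((n + p)`!%:R / p`!%:R) *: 'X^p).

Fact on_monomials_linear n f : linear (@on_monomials n f).
Proof.
move=> a q r; rewrite /on_monomials scaler_sumr -big_split /=.
by apply: eq_bigr => i _; rewrite coefD coefZ scalerDl scalerA.
Qed.
HB.instance Definition _ n f :=
  GRing.isLinear.Build K _ _ *:%R (@on_monomials n f)
    (@on_monomials_linear n f).

Lemma monomial_opE n f (q : {poly_n.+1 K}) :
  monomial_op n f q = \sum_(p < n.+1) q`_p *: npolyp n.+1 (f p).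
Proof. by rewrite lfunE. Qed.

Lemma monomial_op_monomial n (f : nat -> {poly K}) (p : 'I_n.+1) : (size (f p) <= n.+1)%N ->
  monomial_op n f (npolyp n.+1 'X^p) = f p :> {poly K}.
Proof.
move=> fp; rewrite monomial_opE (bigD1 p) //= big1 ?addr0 => [|i neq_ip].
  by rewrite coef_npolyp ltn_ord coefXn eqxx scale1r npolypK.
rewrite -val_eqE in neq_ip.
by rewrite coef_npolyp ltn_ord coefXn (negPf neq_ip) scale0r.
Qed.

Lemma fps_mul_poly (P : {poly K}) s N k : (k < N)%N ->
  fps_mul (nth 0 P) s k = (P * \poly_(i < N) s i)`_k.
Proof.
move=> kN; rewrite coefM; apply: eq_bigr => i _.
by rewrite coef_poly (leq_ltn_trans (leq_subr _ _) kN).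
Qed.

Lemma fps_mulA (P Q : {poly K}) s k :
  fps_mul (nth 0 (P * Q)) s k = fps_mul (nth 0 P) (fps_mul (nth 0 Q) s) k.
Proof.
rewrite (fps_mul_poly _ _ (ltnSn k)) -mulrA coefM; apply: eq_bigr => i _.
by rewrite -fps_mul_poly // ltnS leq_subr.
Qed.

Lemma size_shift_diff (q : {poly K}) :
  (size (q - (q \Po ('X - 1)))%R <= (size q).-1)%N.
Proof.
have -> : q - (q \Po ('X - 1)) = (q \Po 'X) - (q \Po ('X - 1)).
  by rewrite comp_polyXr.
rewrite !comp_polyE -sumrB.
apply: (leq_trans (size_sum _ _ _)); apply/bigmax_leqP => i _.
rewrite -scalerBr (leq_trans (size_scale_leq _ _)) // subrXX.
rewrite opprB addrC subrK mul1r (leq_trans (size_sum _ _ _)) //.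
apply/bigmax_leqP => j _; rewrite -['X - 1]/('X - 1%:P).
rewrite (leq_trans (size_polyMleq _ _)) // size_polyXn size_exp_XsubC.
by have := ltn_ord j; have := ltn_ord i; lia.
Qed.

Lemma size_exp_1subX k : (size ((1 - 'X) ^+ k : {poly K})%R <= k.+1)%N.
Proof.
rewrite (leq_trans (size_poly_exp_leq _ _)) //.
by rewrite -opprB size_polyN -['X - 1]/('X - 1%:P) size_XsubC mul1n.
Qed.

Lemma finite_difference N M (q : {poly K}) x : (size q <= N)%N -> (N < M)%N ->
  \sum_(i < M) ((1 - 'X) ^+ N : {poly K})`_i * q.[x - i%:R] = 0.
Proof.
elim: N M q x => [|N IH] [//|M] q x sq NM.
  by move: sq; rewrite leqn0 size_poly_eq0 => /eqP->;
     rewrite big1 // => i _; rewrite horner0 mulr0.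
have sz : (size ((1 - 'X) ^+ N : {poly K}) <= M)%N.
  exact: leq_trans (size_exp_1subX N) _.
have sd : (size (q - (q \Po ('X - 1)))%R <= N)%N.
  by rewrite (leq_trans (size_shift_diff q)) // -ltnS; case: (size q) sq.
rewrite -[RHS](IH M _ x sd NM) exprSr mulrBr mulr1.
under eq_bigr do rewrite coefB mulrBl.
rewrite sumrB big_ord_recr /= [_`_M]nth_default // mul0r addr0.
rewrite [X in _ - X]big_ord_recl coefMX eqxx mul0r add0r -sumrB.
apply: eq_bigr => i _; rewrite coefMX /= hornerD hornerN horner_comp mulrBr.
by rewrite !hornerE /bump add1n -natr1 opprD addrA.
Qed.

Lemma eulerP k :
  nth 0 (euler k) =1 fps_mul (nth 0 ((1 - 'X) ^+ k.+1)) (fun m => m%:R ^+ k).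
Proof.
move=> j; rewrite coef_poly; case: ltnP => // kj; symmetry.
rewrite -[RHS](@finite_difference k.+1 j.+1 'X^k j%:R) ?size_polyXn //.
by apply: eq_bigr => i _; rewrite hornerXn natrB // -ltnS.
Qed.

Lemma size_opU n (p : 'I_n.+1) :
  (size ((n`!%:R)^-1 *: ((1 - 'X) ^+ (n - p) * euler p)) <= n.+1)%N.
Proof.
rewrite (leq_trans (size_scale_leq _ _)) //.
rewrite (leq_trans (size_polyMleq _ _)) //.
have s1 := size_exp_1subX (n - p).
have s2 : (size (euler p) <= p.+1)%N by apply: size_poly.
rewrite -subn1 leq_subLR (leq_trans (leq_add s1 s2)) //.
by have := ltn_ord p; lia.
Qed.

Lemma size_opV n (p : 'I_n.+1) :
  (size ((1 + 'X) ^+ (n - p) * 'X^p : {poly K})%R <= n.+1)%N.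
Proof.
rewrite (leq_trans (size_polyMleq _ _)) // size_polyXn addrC addnS /=.
have s1 := size_poly_exp_leq ('X + 1%:P : {poly K}) (n - p).
rewrite size_XaddC mul1n in s1.
by rewrite (leq_trans (leq_add s1 (leqnn p))) // addSn subnK // -ltnS.
Qed.

Lemma opU_monomial n (p : 'I_n.+1) :
  opU n (npolyp n.+1 'X^p) =
    (n`!%:R)^-1 *: ((1 - 'X) ^+ (n - p) * euler p) :> {poly K}.
Proof. by rewrite monomial_op_monomial ?size_opU. Qed.

Lemma opU_series n (q : {poly_n.+1 K}) :
  nth 0 (opU n q) =1 fps_mul (nth 0 ((1 - 'X) ^+ n.+1))
                             (fun m => (n`!%:R)^-1 * q.[m%:R]).
Proof.
move=> j; rewrite monomial_opE coefn_sum /fps_mul.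
have qE m : q.[m] = \sum_(p < n.+1) q`_p * m ^+ p.
  by rewrite (horner_coef_wide _ (size_npoly q)).
under [RHS]eq_bigr do rewrite qE !mulr_sumr.
rewrite exchange_big; apply: eq_bigr => p _ /=.
rewrite coefZ npolypK ?size_opU // coefZ coefM.
transitivity (q`_p * ((n`!%:R)^-1 * fps_mul (nth 0 ((1 - 'X) ^+ (n - p)))
    (fps_mul (nth 0 ((1 - 'X) ^+ p.+1)) (fun m => m%:R ^+ p)) j)).
  by congr (_ * (_ * _)); apply: eq_bigr => i _; rewrite eulerP.
rewrite -fps_mulA -exprD.
have -> : (n - p + p.+1 = n.+1)%N by have := ltn_ord p; lia.
rewrite /fps_mul !mulr_sumr; apply: eq_bigr => i _.
by ring.
Qed.

(* Hence inv_lfun is the genuine two-sided inverse of opU n; likewise for opV. *)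
Lemma lker0_opU n : lker (opU n) == 0%VS.
Proof.
apply/lker0P => q r /eqP; rewrite -subr_eq0 -linearB => /eqP U0.
apply/eqP; rewrite -subr_eq0; move: (q - r) U0 => {r}q U0.
have q0 m : q.[m%:R] = 0 :> K.
  elim/ltn_ind: m => m IH; have := opU_series q m.
  rewrite U0 coef0 /fps_mul big_ord_recl subn0 big1 => [|i _]; last first.
    by rewrite IH ?mulr0 ?mulr0 //= /bump add1n; have := ltn_ord i; lia.
  rewrite addr0 -horner_coef0 !hornerE /= subr0 expr1n mul1r.
  by move/esym/eqP; rewrite mulf_eq0 invr_eq0 pnatr_eq0 eqn0Ngt fact_gt0 => /eqP.
rewrite -val_eqE /=; apply/eqP.
apply: (@roots_geq_poly_eq0 _ _ [seq m%:R | m <- iota 0 n.+1]).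
- by apply/allP => _ /mapP[m _ ->]; rewrite rootE q0.
- by rewrite map_inj_uniq ?iota_uniq // => a b /eqP; rewrite eqr_nat => /eqP.
- by rewrite size_map size_iota size_npoly.
Qed.

Lemma opF_monomial n (p : 'I_n.+1) :
  nth 0 (opF n (npolyp n.+1 'X^p)) =1
    fps_mul (nth 0 ((1 - 'X) ^+ (2 * n).+1))
            (fun m => m%:R ^+ p * 'C(m + n, n)%:R).
Proof.
move=> j; rewrite monomial_op_monomial ?size_poly // coef_poly.
case: ltnP => // nj; symmetry.
pose B : {poly K} := \prod_(l < n) ('X - (- (l.+1)%:R)%:P).
pose Q : {poly K} := (n`!%:R)^-1 *: ('X^p * B).
have sQ : (size Q <= (2 * n).+1)%N.
  rewrite (leq_trans (size_scale_leq _ _)) // (leq_trans (size_polyMleq _ _)) //.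
  rewrite size_polyXn size_prod_XsubC /index_enum -enumT size_enum_ord.
  by have := ltn_ord p; lia.
have QE m : Q.[m%:R] = m%:R ^+ p * 'C(m + n, n)%:R.
  rewrite hornerZ hornerM hornerXn mulrCA; congr (_ * _).
  have nz : n`!%:R != 0 :> K by rewrite pnatr_eq0 -lt0n fact_gt0.
  apply: (mulfI nz); rewrite mulVKf // -natrM mulnC bin_ffact.
  rewrite horner_prod; under eq_bigr do rewrite hornerXsubC opprK -natrD.
  rewrite -natr_prod; congr _%:R; rewrite /B {Q B sQ nz nj}.
  elim: n {p} => [|n IH]; first by rewrite big_ord0 ffactn0.
  by rewrite big_ord_recr /= IH addnS ffactSS mulnC.
have QV l : (0 < l <= n)%N -> Q.[- l%:R] = 0.
  case: l => // l /= ln; apply/eqP; rewrite -rootE.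
  rewrite rootZ ?invr_eq0 ?pnatr_eq0 -?lt0n ?fact_gt0 //.
  rewrite rootM; apply/orP; right; rewrite /B (bigD1 (Ordinal ln)) //=.
  by rewrite rootM root_XsubC eqxx.
have := @finite_difference (2 * n).+1 (j.+1 + (2 * n).+1) Q j%:R sQ.
rewrite addSn ltnS leq_addl => /(_ isT); rewrite -addSn.
rewrite big_split_ord /= [X in _ + X]big1 ?addr0 => [H|i _].
  rewrite -[RHS]H //; apply: eq_bigr => i _.
  by rewrite -natrB ?QE // -ltnS.
have [le_in|lt_ni] := leqP (j.+1 + i)%N (2 * n).+1; last first.
  by rewrite [_`_ _]nth_default ?mul0r // (leq_trans (size_exp_1subX _)) //.
by rewrite addSnnS natrD opprD addrA subrr add0r QV ?mulr0 //; lia.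
Qed.

Lemma opV_monomial n (p : 'I_n.+1) :
  opV n (npolyp n.+1 'X^p) = (1 + 'X) ^+ (n - p) * 'X^p :> {poly K}.
Proof. by rewrite monomial_op_monomial ?size_opV. Qed.

Lemma lker0_opV n : lker (opV n) == 0%VS.
Proof.
pose W (q : {poly K}) : {poly K} :=
  \sum_(i < n.+1) q`_i *: ((1 - 'X) ^+ (n - i) * 'X^i).
have WD : {morph W : q r / q + r}.
  move=> q r; rewrite /W -big_split /=.
  by apply: eq_bigr => i _; rewrite coefD scalerDl.
have W0 : W 0 = 0 by rewrite /W big1 // => i _; rewrite coef0 scale0r.
have WZ a q : W (a *: q) = a *: W q.
  by rewrite /W scaler_sumr; apply: eq_bigr => i _; rewrite coefZ scalerA.
have WX i : (i <= n)%N -> W 'X^i = (1 - 'X) ^+ (n - i) * 'X^i.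
  move=> le_in; rewrite /W (bigD1 (inord i)) //= inordK // coefXn eqxx scale1r.
  rewrite big1 ?addr0 // => j; rewrite -val_eqE /= inordK // => ne.
  by rewrite coefXn (negPf ne) scale0r.
have WV p : (p <= n)%N -> W ((1 + 'X) ^+ (n - p) * 'X^p) = 'X^p.
  move=> le_pn; rewrite exprDn mulr_suml (big_morph W WD W0).
  transitivity (((1 - 'X) + 'X) ^+ (n - p) * 'X^p : {poly K}); last first.
    by rewrite subrK expr1n mul1r.
  rewrite exprDn mulr_suml; apply: eq_bigr => i _.
  rewrite expr1n mul1r mulrnAl -exprD -scaler_nat WZ WX; last first.
    by have := ltn_ord i; lia.
  by rewrite exprD (addnC i) subnDA mulrnAl -scaler_nat mulrA.
apply/lker0P => q r /(congr1 (W \o val)) /=.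
suff VK s : W (opV n s) = s by rewrite !VK => /val_inj.
rewrite monomial_opE raddf_sum (big_morph W WD W0) /=.
rewrite [RHS](npolyX_gen (size_npoly s)) raddf_sum; apply: eq_bigr => i _.
have le_in : (i <= n)%N by rewrite -ltnS.
by rewrite /= npolyXE npolypK ?size_opV // WZ WV.
Qed.

Lemma opC_monomial n (p : 'I_n.+1) :
  opC n (npolyp n.+1 'X^p) = ((n + p)`!%:R / p`!%:R) *: 'X^p :> {poly K}.
Proof.
rewrite monomial_op_monomial // (leq_trans (size_scale_leq _ _)) //.
by rewrite size_polyXn.
Qed.

End Operators.

(* Main.v *)
Require Import Defs.
From mathcomp Require Import all_boot all_order all_algebra reals complex.
From mathcomp Require Import zify ring.

(** The proof evaluates both sides on [(1 - x)^(n-p) x^p = V_n^-1 x^p].  This is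
    [n!] times the image under [U_n] of the binomial polynomial [binom(x, p)],
    because [\sum_m binom(m, p) x^m = x^p / (1 - x)^(p+1)].  Since
    [binom(m, p) binom(m+n, n) = binom(n+p, p) binom(m+n, n+p)], the operator
    [F_n] maps [binom(x, p)] to [binom(n+p, p) (1 - x)^(n-p) x^p], so that
    [F_n U_n^-1] is diagonal on these polynomials, with the eigenvalues
    [(n+p)!/p!] of [C_n]. *)

Set Implicit Arguments.
Unset Strict Implicit.
Unset Printing Implicit Defensive.

Import Order.TTheory GRing.Theory Num.Theory.
Local Open Scope ring_scope.

Section Operators.
Variable K : numFieldType.
Implicit Types (n p : nat) (s t : nat -> K).

(** * Generating series of binomial coefficients *)

Lemma eq_fps_mulr (a s t : nat -> K) : s =1 t -> fps_mul a s =1 fps_mul a t.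
Proof. by move=> st k; apply: eq_bigr => i _; rewrite st. Qed.

Lemma fps_mulZr (a s : nat -> K) c :
  fps_mul a (fun m => c * s m) =1 fun j => c * fps_mul a s j.
Proof.
by move=> j; rewrite /fps_mul mulr_sumr; apply: eq_bigr => i _; rewrite mulrCA.
Qed.

Lemma fps_mulX s j :
  fps_mul (nth 0 ('X : {poly K})) s j = if j is j'.+1 then s j' else 0.
Proof.
rewrite (fps_mul_poly _ _ (ltnSn j)) coefXM.
by case: j => //= j; rewrite coef_poly ltnS leqnSn.
Qed.

Lemma fps_mul_1subX s j :
  fps_mul (nth 0 (1 - 'X : {poly K})) s j =
  s j - (if j is j'.+1 then s j' else 0).
Proof.
rewrite -fps_mulX !(fps_mul_poly _ _ (ltnSn j)) mulrBl mul1r coefB.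
by rewrite coef_poly ltnSn.
Qed.

(** Each factor 1 - x takes a backward difference of the coefficients. By Pascal's rule this lowers
    [r] by one; at [r = 0] it turns the series of C(m, p+1) into x times that of C(m, p). *)
Lemma binomial_series r p :
  fps_mul (nth 0 ((1 - 'X) ^+ (r + p).+1 : {poly K}))
          (fun m => 'C(m + r, r + p)%:R) =1 nth 0 ('X^p : {poly K}).
Proof.
elim: r => [|r IHr] j.
  under eq_fps_mulr do rewrite addn0 add0n.
  elim: p j => [|p IHp] j.
    rewrite expr1 fps_mul_1subX expr0 coef1.
    by case: j => [|j]; rewrite !bin0 ?subr0 ?subrr.
  rewrite add0n exprSr fps_mulA.
  rewrite (@eq_fps_mulr _ _
      (fps_mul (nth 0 ('X : {poly K})) (fun m => 'C(m, p)%:R))); last first.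
    move=> i; rewrite fps_mul_1subX fps_mulX.
    by case: i => [|i]; rewrite ?bin0n ?subr0 // binS natrD addrAC subrr add0r.
  rewrite -fps_mulA mulrC fps_mulA (eq_fps_mulr _ IHp).
  by rewrite fps_mulX exprS coefXM; case: j.
rewrite -[RHS]IHr addSn exprSr fps_mulA; apply: eq_fps_mulr => i.
rewrite fps_mul_1subX addnS binS natrD.
case: i => [|i]; last by rewrite addnS addSn addrAC subrr add0r.
(* There is no preceding coefficient at m = 0, and the Pascal term C(r, r+p+1) that it would cancel
   is zero. *)
by rewrite add0n bin_small ?ltnS ?leq_addr // add0r subr0.
Qed.

(** * Binomial polynomials and their values at integers *)

Definition binomial_poly p : {poly K} :=
  (p`!%:R)^-1 *: \prod_(l < p) ('X - (l%:R)%:P).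

Lemma size_binomial_poly p : (size (binomial_poly p) <= p.+1)%N.
Proof.
rewrite (leq_trans (size_scale_leq _ _)) // size_prod_XsubC.
by rewrite /index_enum -enumT size_enum_ord.
Qed.

Lemma horner_binomial_poly p m : (binomial_poly p).[m%:R] = 'C(m, p)%:R.
Proof.
have nz : p`!%:R != 0 :> K by rewrite pnatr_eq0 -lt0n fact_gt0.
apply: (mulfI nz); rewrite hornerZ mulVKf // -natrM mulnC bin_ffact.
rewrite horner_prod {nz}; elim: p => [|p IH]; first by rewrite big_ord0 ffactn0.
rewrite big_ord_recr /= IH ffactnSr natrM !hornerE.
(* For m < p the natural number [m - p] is truncated to 0, but the falling factorial before it
   already vanishes. *)
have [le_pm|lt_mp] := leqP p m; first by rewrite natrB.
by rewrite ffact_small // !mul0r.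
Qed.

(** Lets [opF] be computed from the values of [q] at integers, which are known for [binomial_poly],
    unlike its coefficients. *)
Lemma opF_series n (q : {poly_n.+1 K}) :
  nth 0 (opF K n q) =1 fps_mul (nth 0 ((1 - 'X) ^+ (2 * n).+1))
                               (fun m => q.[m%:R] * 'C(m + n, n)%:R).
Proof.
move=> j; rewrite monomial_opE coefn_sum /fps_mul.
have qE m : q.[m] = \sum_(p < n.+1) q`_p * m ^+ p.
  by rewrite (horner_coef_wide _ (size_npoly q)).
under [RHS]eq_bigr do rewrite qE mulr_suml mulr_sumr.
rewrite exchange_big; apply: eq_bigr => p _ /=.
have := opF_monomial K p j; rewrite monomial_op_monomial ?size_poly //.
rewrite coefZ npolypK ?size_poly // => ->; rewrite mulr_sumr.
by apply: eq_bigr => i _; ring.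
Qed.

(** * Preimages of the monomials under V_n *)

Definition invV_monomial n p : {poly_n.+1 K} :=
  npolyp n.+1 ((1 - 'X) ^+ (n - p) * 'X^p).

Lemma invV_monomialE n (p : 'I_n.+1) :
  invV_monomial n p = (1 - 'X) ^+ (n - p) * 'X^p :> {poly K}.
Proof.
rewrite npolypK // (leq_trans (size_polyMleq _ _)) // size_polyXn addnS /=.
rewrite (leq_trans (leq_add (size_exp_1subX K (n - p)) (leqnn p))) //.
by rewrite addSn subnK // -ltnS.
Qed.

Lemma opV_invV_monomial n (p : 'I_n.+1) :
  opV K n (invV_monomial n p) = npolyp n.+1 'X^p.
Proof.
(* [W] is [opV] on polynomials without a degree bound, so that it applies termwise to the binomial
   expansion of (1 - x)^(n-p). *)
pose W (q : {poly K}) : {poly K} :=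
  \sum_(i < n.+1) q`_i *: ((1 + 'X) ^+ (n - i) * 'X^i).
have WD : {morph W : q r / q + r}.
  move=> q r; rewrite /W -big_split /=.
  by apply: eq_bigr => i _; rewrite coefD scalerDl.
have W0 : W 0 = 0 by rewrite /W big1 // => i _; rewrite coef0 scale0r.
have WZ a q : W (a *: q) = a *: W q.
  by rewrite /W scaler_sumr; apply: eq_bigr => i _; rewrite coefZ scalerA.
have WX i : (i <= n)%N -> W 'X^i = (1 + 'X) ^+ (n - i) * 'X^i.
  move=> le_in; rewrite /W (bigD1 (inord i)) //= inordK // coefXn eqxx scale1r.
  rewrite big1 ?addr0 // => j; rewrite -val_eqE /= inordK // => ne.
  by rewrite coefXn (negPf ne) scale0r.
have le_pn : (p <= n)%N by rewrite -ltnS.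
apply: val_inj; rewrite /= npolypK ?size_polyXn //.
have -> : opV K n (invV_monomial n p) = W (invV_monomial n p) :> {poly K}.
  rewrite monomial_opE raddf_sum; apply: eq_bigr => i _ /=.
  by rewrite npolypK ?size_opV.
rewrite invV_monomialE exprDn mulr_suml (big_morph W WD W0).
(* The images of the terms of that expansion are the terms of this one. *)
transitivity (((1 + 'X) - 'X) ^+ (n - p) * 'X^p : {poly K}); last first.
  by rewrite addrK expr1n mul1r.
rewrite exprDn mulr_suml; apply: eq_bigr => i _.
have le_i : (i <= n - p)%N by rewrite -ltnS.
rewrite expr1n mul1r -scaleN1r exprZn !mulrnAl -!scalerAl -exprD.
rewrite -!scaler_nat !WZ WX; last by lia.
by rewrite -scalerAr -scalerAl exprD mulrA [(i + p)%N]addnC subnDA.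
Qed.

(** * U_n and F_n on the binomial polynomials *)

Lemma opU_binomial_poly n (p : 'I_n.+1) :
  opU K n (npolyp n.+1 (binomial_poly p)) = n`!%:R^-1 *: invV_monomial n p.
Proof.
apply/val_inj/polyP => j; rewrite opU_series /= coefZ invV_monomialE.
rewrite fps_mulZr; congr (_ * _).
have le_pn : (p <= n)%N by rewrite -ltnS.
rewrite npolypK ?(leq_trans (size_binomial_poly p)) //.
(* The power p+1 sums the series of C(m, p) to x^p; the power n-p remains. *)
have -> : (1 - 'X : {poly K}) ^+ n.+1 = (1 - 'X) ^+ (n - p + p.+1).
  by rewrite addnS subnK.
rewrite exprD fps_mulA coefM.
apply: eq_bigr => i _; congr (_ * _).
rewrite -[RHS](binomial_series 0); apply: eq_fps_mulr => m.
by rewrite horner_binomial_poly addn0.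
Qed.

(** Both sides are (m+n)! / (p! (m-p)! n!) if p <= m, and 0 otherwise. *)
Lemma bin_mul_bin_addl m n p :
  ('C(m, p) * 'C(m + n, n) = 'C(n + p, p) * 'C(m + n, n + p))%N.
Proof.
have [le_pm|lt_mp] := leqP p m; last first.
  by rewrite bin_small // [in RHS](@bin_small (m + n)) ?muln0 // addnC ltn_add2l.
have h1 := bin_fact le_pm.
have h2 := bin_fact (leq_addl m n).
have h3 := bin_fact (leq_addl n p).
have h4 : ('C(m + n, n + p) * ((n + p)`! * (m - p)`!) = (m + n)`!)%N.
  rewrite -(@bin_fact (m + n) (n + p)); last by lia.
  by have -> : (m + n - (n + p) = m - p)%N by lia.
rewrite addnK -h1 in h2; rewrite addnK in h3; rewrite -h3 -h2 in h4.
have gt0 : (0 < p`! * (m - p)`! * n`!)%N by rewrite !muln_gt0 !fact_gt0.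
by apply/eqP; rewrite -(eqn_pmul2r gt0); apply/eqP; lia.
Qed.

Lemma opF_binomial_poly n (p : 'I_n.+1) :
  opF K n (npolyp n.+1 (binomial_poly p)) =
  'C(n + p, p)%:R *: invV_monomial n p.
Proof.
apply/val_inj/polyP => j; rewrite opF_series /= coefZ invV_monomialE.
have le_pn : (p <= n)%N by rewrite -ltnS.
rewrite npolypK ?(leq_trans (size_binomial_poly p)) //.
under eq_fps_mulr do
  rewrite horner_binomial_poly -natrM bin_mul_bin_addl natrM.
rewrite fps_mulZr; congr (_ * _).
(* The power n+p+1 is the one in [binomial_series] with [r = n]. *)
have -> : ((2 * n).+1 = (n - p) + (n + p).+1)%N by lia.
rewrite exprD fps_mulA coefM; apply: eq_bigr => i _; congr (_ * _).
exact: binomial_series.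
Qed.

Lemma invU_invV_monomial n (p : 'I_n.+1) :
  ((opU K n)^-1)%VF (invV_monomial n p) =
  n`!%:R *: npolyp n.+1 (binomial_poly p).
Proof.
have nz : n`!%:R != 0 :> K by rewrite pnatr_eq0 -lt0n fact_gt0.
apply: (lker0P (lker0_opU K n)).
rewrite lker0_lfunVK ?lker0_opU //.
by rewrite linearZ /= opU_binomial_poly scalerA divff // scale1r.
Qed.

Lemma opF_invU_invV_monomial n (p : 'I_n.+1) :
  opF K n (((opU K n)^-1)%VF (invV_monomial n p)) =
  ((n + p)`!%:R / p`!%:R) *: invV_monomial n p.
Proof.
rewrite invU_invV_monomial linearZ /= opF_binomial_poly scalerA; congr (_ *: _).
have nz : p`!%:R != 0 :> K by rewrite pnatr_eq0 -lt0n fact_gt0.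
have := bin_fact (leq_addl n p); rewrite addnK => <-.
by rewrite !natrM; field.
Qed.

Lemma opF_invU n :
  (opF K n \o (opU K n)^-1)%VF = ((opV K n)^-1 \o (opC K n \o opV K n))%VF.
Proof.
have VK q : ((opV K n)^-1)%VF (opV K n q) = q by rewrite lker0_lfunK ?lker0_opV.
have Vinj := lker0P (lker0_opV K n).
have VKV q : opV K n (((opV K n)^-1)%VF q) = q.
  by rewrite lker0_lfunVK ?lker0_opV.
apply/lfunP => q; rewrite !comp_lfunE; apply: Vinj; rewrite VKV.
(* With V_n q as the new variable, it suffices by linearity to let it be x^p, so that F_n U_n^-1 is
   applied to [invV_monomial]. *)
rewrite -[q in LHS]VK; move: (opV K n q) => {}q.
have -> : q = \sum_(p < n.+1) q`_p *: npolyp n.+1 'X^p.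
  apply: val_inj; rewrite raddf_sum [LHS](npolyX_gen (size_npoly q)) raddf_sum.
  apply: eq_bigr => p _ /=; congr (_ *: _).
  by rewrite npolyXE npolypK // size_polyXn.
rewrite !linear_sum; apply: eq_bigr => p _; rewrite !linearZ; congr (_ *: _).
rewrite -opV_invV_monomial /= VK opF_invU_invV_monomial linearZ /=.
apply: val_inj; rewrite /= opV_invV_monomial opC_monomial.
by rewrite npolypK // size_polyXn.
Qed.

End Operators.

Theorem theorem12 (R : realType) (n : nat) :
  (opF R[i] n \o (opU R[i] n)^-1)%VF =
  ((opV R[i] n)^-1 \o (opC R[i] n \o opV R[i] n))%VF.
Proof. exact: opF_invU. Qed.
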